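(* For any real number $t \neq 0$ and any complex number $\lambda$, there exists a subset $S \subseteq \mathbb{Z}^{\geq 2}$ such that $$\sum_{n\in S}\frac{1}{n} < \infty \qquad\text{and}\qquad \sum_{n\in S}\frac{1}{n^{1+it}} = \lambda.$$
   Context: $\mathbb{Z}^{\geq 2}$ denotes the set of integers $n \geq 2$; the set $S$ may be finite or infinite. Here $i$ is the imaginary unit, and for a positive integer $n$, $n^{1+it} = \exp((1+it)\log n)$ with $\log n$ the real logarithm. *)

(* Defs.v *)
From Stdlib Require Export Reals ClassicalEpsilon.
From Coquelicot Require Export Coquelicot.
Open Scope R_scope.

(* exp (a + i b) = e^a (cos b + i sin b) *)
Definition Cexp (z : C) : C :=
  (exp (Re z) * cos (Im z), exp (Re z) * sin (Im z)).

(* n^s for n >= 1, with the real logarithm of n; the value at n = 0 is junk. *)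
Definition nat_Cpow (n : nat) (s : C) : C :=
  Cexp (Cmult s (RtoC (ln (INR n)))).

(* A sum over S is rendered as a series over nat whose terms outside S are
   zero, i.e. the elements of S are taken in increasing order.  The order is
   immaterial for nonnegative or absolutely convergent series. *)
Definition restrict_to {V : AbelianMonoid} (S : nat -> Prop) (a : nat -> V)
    (n : nat) : V :=
  if excluded_middle_informative (S n) then a n else zero.

(* Main.v *)
Require Import Defs.
From Stdlib Require Import Lra Lia.

(** Greedy choice: keep a remainder [r], initially [lambda], and use the term
    [a n] exactly when it is short compared with [r] and makes an angle at most
    60 degrees with it.  Each term used shortens [r] by at least a quarter of its own
    length, so the terms used are absolutely summable.  If the remainders did
    not tend to [0] they would eventually stay in a narrow cone around one of
    them, and every later term with direction in a slightly narrower cone would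
    be used.  For [a n = n^(-1-it)] this contradicts summability: the [n] with
    [t ln n] close to a given angle modulo [2 PI] fill blocks [A, QA] with [Q]
    fixed, and each block contributes at least a constant to the sum of [1/n]. *)

(** [Re (Cconj u * a n)] is the Euclidean inner product of [u] and [a n], so the cosine of their
    angle is at least 3/4. [useful] asks only for 1/2; the slack allows [u] to be replaced by a
    nearby remainder. *)
Definition aligned (a : nat -> C) (u : C) (n : nat) : Prop :=
  3 / 4 * (Cmod u * Cmod (a n)) <= Re (Cconj u * a n)%C.

Definition useful (m : nat) (a : nat -> C) (r : C) (n : nat) : Prop :=
  (m <= n)%nat /\ 2 * Cmod (a n) <= Cmod r /\
  Cmod r * Cmod (a n) <= 2 * Re (Cconj r * a n)%C.

Fixpoint remainder (m : nat) (a : nat -> C) (l : C) (n : nat) : C :=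
  match n with
  | O => l
  | S k =>
      let r := remainder m a l k in
      if excluded_middle_informative (useful m a r k) then Cminus r (a k) else r
  end.

Definition greedy (m : nat) (a : nat -> C) (l : C) (n : nat) : Prop :=
  useful m a (remainder m a l n) n.

(** * Effect of one greedy step on the modulus *)

Lemma Cmod_sqr (z : C) : Cmod z * Cmod z = Re z * Re z + Im z * Im z.
Proof.
  pose proof (Cmod2_alt z) as H. simpl in H. lra.
Qed.

Lemma Cmod_Cminus_sqr (r z : C) :
  Cmod (r - z)%C * Cmod (r - z)%C =
  Cmod r * Cmod r - 2 * Re (Cconj r * z)%C + Cmod z * Cmod z.
Proof.
  rewrite !Cmod_sqr. destruct r as [x y], z as [x' y'].
  unfold Cconj, Cminus, Cplus, Copp, Cmult, Re, Im; simpl. ring.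
Qed.

Lemma Re_Cconj_mult_le (u z : C) : Re (Cconj u * z)%C <= Cmod u * Cmod z.
Proof.
  rewrite <- (Cmod_conj u), <- Cmod_mult.
  eapply Rle_trans; [apply Rle_abs | apply re_le_Cmod].
Qed.

Lemma useful_shortens (m : nat) (a : nat -> C) (r : C) (n : nat) :
  useful m a r n -> Cmod (r - a n)%C <= Cmod r - / 4 * Cmod (a n).
Proof.
  intros (_ & H1 & H2).
  pose proof (Cmod_Cminus_sqr r (a n)) as E.
  pose proof (Cmod_ge_0 (a n)). pose proof (Cmod_ge_0 (r - a n)%C).
  apply Rsqr_incr_0_var; [unfold Rsqr | lra].
  (* The left square is at most [|r|^2 - |r||a| + |a|^2]. The right one exceeds this by
     [|r||a|/2 - 15/16 |a|^2], which is nonnegative since [|r| >= 2|a|]. *)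
  nra.
Qed.

(** * Telescoping and summability of the selected terms *)

Lemma sum_greedy (m : nat) (a : nat -> C) (l : C) (n : nat) :
  sum_n (restrict_to (V := C_AbelianMonoid) (greedy m a l) a) n =
  (l - remainder m a l (S n))%C :> C.
Proof.
  (* Each summand is the drop between consecutive remainders, so the partial sums telescope. *)
  assert (H : forall k, restrict_to (V := C_AbelianMonoid) (greedy m a l) a k =
    (remainder m a l k - remainder m a l (S k))%C :> C).
  { intros k. unfold restrict_to, greedy. simpl.
    destruct (excluded_middle_informative _).
    - ring.
    - change (@zero C_AbelianMonoid) with (RtoC 0). ring. }
  induction n as [|n IH].
  - rewrite sum_O, H. reflexivity.
  - rewrite sum_Sn, IH, H.
    change (@plus C_AbelianMonoid) with Cplus. ring.
Qed.

Lemma restrict_to_ge_0 (P : nat -> Prop) (b : nat -> R) (n : nat) :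
  (forall k, 0 <= b k) -> 0 <= restrict_to (V := R_AbelianMonoid) P b n.
Proof.
  intros H. unfold restrict_to. destruct (excluded_middle_informative _).
  - apply H.
  - apply Rle_refl.
Qed.

Lemma remainder_step (m : nat) (a : nat -> C) (l : C) (n : nat) :
  Cmod (remainder m a l (S n) - remainder m a l n)%C =
    restrict_to (V := R_AbelianMonoid) (greedy m a l) (fun k => Cmod (a k)) n /\
  Cmod (remainder m a l (S n)) <= Cmod (remainder m a l n) -
    / 4 * restrict_to (V := R_AbelianMonoid) (greedy m a l) (fun k => Cmod (a k)) n.
Proof.
  unfold restrict_to, greedy. simpl.
  destruct (excluded_middle_informative _) as [H|H].
  - split; [| now apply (useful_shortens m)].
    rewrite <- (Cmod_opp (a n)). f_equal. ring.
  - change (@zero R_AbelianMonoid) with 0. split; [| lra].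
    rewrite <- Cmod_0. f_equal. ring.
Qed.

Lemma remainder_decr (m : nat) (a : nat -> C) (l : C) (n : nat) :
  Cmod (remainder m a l (S n)) <= Cmod (remainder m a l n).
Proof.
  pose proof (proj2 (remainder_step m a l n)).
  pose proof (restrict_to_ge_0 (greedy m a l) (fun k => Cmod (a k)) n
    (fun k => Cmod_ge_0 (a k))). lra.
Qed.

(** Each step is at most four times as long as the modulus it removes; the triangle inequality adds
    these bounds up. *)
Lemma remainder_drift (m : nat) (a : nat -> C) (l : C) (n k : nat) :
  Cmod (remainder m a l (n + k) - remainder m a l n)%C <=
  4 * (Cmod (remainder m a l n) - Cmod (remainder m a l (n + k))).
Proof.
  induction k as [|k IH].
  - rewrite Nat.add_0_r.
    replace (remainder m a l n - remainder m a l n)%C with (RtoC 0) by ring.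
    rewrite Cmod_0. lra.
  - rewrite Nat.add_succ_r.
    pose proof (remainder_step m a l (n + k)) as [E H]. rewrite <- E in H.
    replace (remainder m a l (S (n + k)) - remainder m a l n)%C with
      ((remainder m a l (S (n + k)) - remainder m a l (n + k)) +
       (remainder m a l (n + k) - remainder m a l n))%C by ring.
    eapply Rle_trans; [apply Cmod_triangle | lra].
Qed.

Lemma greedy_summable (m : nat) (a : nat -> C) (l : C) :
  ex_series (restrict_to (greedy m a l) (fun k => Cmod (a k))).
Proof.
  set (b := restrict_to (V := R_AbelianMonoid) (greedy m a l) (fun k => Cmod (a k))).
  (* The modulus has only [Cmod l] to lose in total, which bounds the sum of all the step
     lengths. *)
  assert (B : forall n, sum_n b n <= 4 * (Cmod l - Cmod (remainder m a l (S n)))).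
  { induction n as [|n IH].
    - rewrite sum_O. pose proof (proj2 (remainder_step m a l 0)) as H.
      fold b in H. change (remainder m a l 0) with l in H. lra.
    - rewrite sum_Sn. pose proof (proj2 (remainder_step m a l (S n))) as H.
      fold b in H. change (@plus R_AbelianMonoid) with Rplus. lra. }
  destruct (ex_finite_lim_seq_incr (sum_n b) (4 * Cmod l)) as [s Hs].
  - intros n. rewrite sum_Sn. change (@plus R_AbelianMonoid) with Rplus.
    assert (0 <= b (S n)) by (apply restrict_to_ge_0; intros; apply Cmod_ge_0).
    lra.
  - intros n. pose proof (B n). pose proof (Cmod_ge_0 (remainder m a l (S n))). lra.
  - exists s. exact Hs.
Qed.

(** * Convergence of the remainders to zero *)

Lemma ex_series_eventually_le (b c : nat -> R) (N : nat) :
  (forall n, (N <= n)%nat -> 0 <= b n <= c n) -> ex_series c -> ex_series b.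
Proof.
  intros H Hc. apply (ex_series_incr_n b N).
  apply (ex_series_incr_n c N) in Hc.
  apply (@ex_series_le R_AbsRing R_CompleteNormedModule) with (2 := Hc).
  intros n. destruct (H (N + n)%nat) as [H0 H1]; [lia|].
  change (norm (b (N + n)%nat)) with (Rabs (b (N + n)%nat)).
  rewrite Rabs_pos_eq; lra.
Qed.

(** Replacing [u] by [r] changes the inner product with [a n] by at most [|u||a n|/4], so at least
    [(3/4 - 1/4)|u||a n| >= |r||a n|/2] remains. *)
Lemma aligned_useful (m : nat) (a : nat -> C) (u r : C) (n : nat) :
  (m <= n)%nat -> 2 * Cmod (a n) <= Cmod r -> Cmod r <= Cmod u ->
  4 * Cmod (r - u)%C <= Cmod u -> aligned a u n -> useful m a r n.
Proof.
  intros Hm Ha Hr Hd Hu. split; [exact Hm | split; [exact Ha |]].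
  unfold aligned in Hu.
  pose proof (Re_Cconj_mult_le (u - r)%C (a n)) as H.
  assert (E : Re (Cconj (u - r) * a n)%C =
    Re (Cconj u * a n)%C - Re (Cconj r * a n)%C).
  { rewrite Cminus_conj. unfold Re, Cmult, Cminus, Cplus, Copp; simpl. ring. }
  assert (F : Cmod (u - r)%C = Cmod (r - u)%C).
  { rewrite <- Cmod_opp. f_equal. ring. }
  rewrite E, F in H.
  pose proof (Cmod_ge_0 (a n)). nra.
Qed.

Lemma remainder_lim (m : nat) (a : nat -> C) (l : C) :
  is_lim_seq (fun n => Cmod (a n)) 0 ->
  (forall u : C, u <> 0 ->
     ~ ex_series (restrict_to (aligned a u) (fun n => Cmod (a n)))) ->
  is_lim_seq (fun n => Cmod (remainder m a l n)) 0.
Proof.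
  intros Ha Hdiv. set (r := remainder m a l).
  destruct (ex_finite_lim_seq_decr (fun n => Cmod (r n)) 0) as [rho Hrho].
  { intros n. apply remainder_decr. }
  { intros n. apply Cmod_ge_0. }
  assert (Hge : forall n, rho <= Cmod (r n)).
  { intros n. apply (is_lim_seq_decr_compare (fun n => Cmod (r n)) rho Hrho).
    intros k. apply remainder_decr. }
  assert (H0 : 0 <= rho).
  { apply (is_lim_seq_le (fun _ => 0) (fun n => Cmod (r n)) 0 rho).
    - intros n. apply Cmod_ge_0.
    - apply is_lim_seq_const.
    - exact Hrho. }
  destruct (Req_dec rho 0) as [-> | Hne]; [exact Hrho | exfalso].
  assert (Hpos : 0 < rho) by lra. clear Hne H0.
  (* With modulus loss below [rho/16], the drift is below [rho/4], a quarter of [Cmod (r N)] at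
     most. Terms shorter than [rho/2] meet the length condition of [useful]. *)
  assert (He : 0 < rho / 16) by lra. assert (He' : 0 < rho / 2) by lra.
  apply is_lim_seq_spec in Hrho. destruct (Hrho (mkposreal _ He)) as [N1 HN1].
  apply is_lim_seq_spec in Ha. destruct (Ha (mkposreal _ He')) as [N2 HN2].
  simpl in HN1, HN2.
  set (N := (N1 + N2 + m)%nat).
  assert (HuN : Cmod (r N) < rho + rho / 16).
  { specialize (HN1 N ltac:(lia)). apply Rabs_def2 in HN1. lra. }
  apply (Hdiv (r N)).
  { intros E. specialize (Hge N). rewrite E, Cmod_0 in Hge. lra. }
  (* From [N] on, every term aligned with [r N] is selected, so the summable greedy series dominates
     the aligned one. *)
  apply ex_series_eventually_le with (2 := greedy_summable m a l) (N := N).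
  intros n Hn. split; [apply restrict_to_ge_0; intros; apply Cmod_ge_0 |].
  assert (Hg := restrict_to_ge_0 (greedy m a l) (fun k => Cmod (a k)) n
    (fun k => Cmod_ge_0 (a k))).
  unfold restrict_to in *. destruct (excluded_middle_informative (aligned a (r N) n))
    as [Hal|]; [| exact Hg].
  destruct (excluded_middle_informative (greedy m a l n)) as [|Hng];
    [apply Rle_refl | exfalso; apply Hng].
  pose proof (remainder_drift m a l N (n - N)) as Hd.
  replace (N + (n - N))%nat with n in Hd by lia. fold r in Hd.
  specialize (HN2 n ltac:(lia)). apply Rabs_def2 in HN2.
  pose proof (Hge n). pose proof (Hge N).
  pose proof (Cmod_ge_0 (r n - r N)%C).
  apply (aligned_useful m a (r N)); try assumption; try (fold r; lra).
  lia.
Qed.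

Lemma is_series_greedy (m : nat) (a : nat -> C) (l : C) :
  is_lim_seq (fun n => Cmod (a n)) 0 ->
  (forall u : C, u <> 0 ->
     ~ ex_series (restrict_to (aligned a u) (fun n => Cmod (a n)))) ->
  is_series (V := C_NormedModule) (restrict_to (greedy m a l) a) l.
Proof.
  intros Ha Hdiv.
  pose proof (remainder_lim m a l Ha Hdiv) as H.
  (* The shift is needed because the partial sum through index [n] leaves the remainder at [S n]. *)
  apply is_lim_seq_incr_1 in H. apply is_lim_seq_spec in H.
  apply filterlim_locally_ball_norm. intros eps.
  destruct (H eps) as [N HN]. exists N. intros n Hn. specialize (HN n Hn).
  change (Cmod (sum_n (restrict_to (V := C_AbelianMonoid) (greedy m a l) a) n - l)%C
    < eps).
  rewrite sum_greedy.
  replace (l - remainder m a l (S n) - l)%C with (- remainder m a l (S n))%C by ring.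
  rewrite Cmod_opp.
  pose proof (Rle_abs (Cmod (remainder m a l (S n)) - 0)). lra.
Qed.

(** * Cosine bound and polar form *)

Lemma cos_PI6_ge (x : R) : Rabs x <= PI / 6 -> 3 / 4 <= cos x.
Proof.
  intros H. pose proof PI_RGT_0.
  assert (3 / 4 <= cos (PI / 6)).
  { rewrite cos_PI6. assert (3 / 2 <= sqrt 3); [| lra].
    apply Rsqr_incr_0_var; [rewrite Rsqr_sqrt; unfold Rsqr; lra | apply sqrt_pos]. }
  assert (cos x = cos (Rabs x)) as ->.
  { unfold Rabs. destruct (Rcase_abs x); [now rewrite cos_neg | reflexivity]. }
  pose proof (Rabs_pos x).
  apply Rle_trans with (1 := H1). apply cos_decr_1; lra.
Qed.

Lemma polar_form (u : C) :
  exists phi, Re u = Cmod u * cos phi /\ Im u = Cmod u * sin phi.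
Proof.
  destruct (Req_dec (Cmod u) 0) as [H0|H0].
  { exists 0. apply Cmod_eq_0 in H0. subst u. rewrite Cmod_0.
    unfold Re, Im; simpl. lra. }
  pose proof (Cmod_ge_0 u).
  set (x := Re u / Cmod u). set (y := Im u / Cmod u).
  assert (Hx : Re u = Cmod u * x) by (unfold x; field; auto).
  assert (Hy : Im u = Cmod u * y) by (unfold y; field; auto).
  assert (Hxy : x * x + y * y = 1).
  { pose proof (Cmod_sqr u) as E. rewrite Hx, Hy in E.
    apply (Rmult_eq_reg_l (Cmod u * Cmod u)); [lra |].
    now apply Rmult_integral_contrapositive. }
  assert (Hb : -1 <= x <= 1) by nra.
  assert (Hs : sqrt (1 - Rsqr x) = Rabs y).
  { rewrite <- sqrt_Rsqr_abs. f_equal. unfold Rsqr. lra. }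
  (* [acos] takes values in [[0, PI]], where the sine is nonnegative, so the sign of [y] decides the
     sign of the angle. *)
  destruct (Rle_dec 0 y) as [Hp|Hn].
  - exists (acos x). rewrite cos_acos, sin_acos, Hs, Rabs_pos_eq; auto.
  - exists (- acos x). rewrite cos_neg, sin_neg, cos_acos, sin_acos, Hs, Rabs_left by lra.
    split; [exact Hx | lra].
Qed.

(** * Divergence of the harmonic sum over geometric blocks *)

Lemma sum_n_m_ge_const (b : nat -> R) (c : R) (p q : nat) :
  (forall n, (p <= n <= q)%nat -> c <= b n) ->
  INR (S q - p) * c <= sum_n_m b p q.
Proof.
  intros H. rewrite <- sum_n_m_const.
  (* [Rmin c (b n)] equals [c] on the range and lies below [b] at every index, as the termwise
     comparison requires. *)
  rewrite (sum_n_m_ext_loc _ (fun n => Rmin c (b n))).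
  - apply sum_n_m_le. intros k. apply Rmin_r.
  - intros k Hk. symmetry. apply Rmin_left, H, Hk.
Qed.

(** A block holds about [(Q - 1) * A] integers, each contributing at least [1/(Q * A)]. Its mass is
    thus bounded below independently of [A], against the Cauchy criterion. *)
Lemma harmonic_blocks_diverge (P : nat -> Prop) (Q : R) :
  1 < Q ->
  (forall M, exists A, M <= A /\
     forall n : nat, A <= INR n <= Q * A -> P n) ->
  ~ ex_series (restrict_to P (fun n => / INR n)).
Proof.
  intros HQ HP Hs.
  assert (He : 0 < (1 - / Q) / 4).
  { assert (/ Q < 1) by (rewrite <- Rinv_1; apply Rinv_lt_contravar; lra). lra. }
  apply (@Cauchy_ex_series R_AbsRing R_CompleteNormedModule) in Hs.
  destruct (Hs (mkposreal _ He)) as [N HN]. simpl in HN.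
  (* [A] must be positive, lie past the Cauchy index, and satisfy [(Q - 1) * A >= 2], so that
     rounding to integers costs at most half of the block. The mass is then at least
     [(1 - / Q) / 2], twice the Cauchy tolerance. *)
  destruct (HP (Rmax (Rmax 1 (INR N)) (2 / (Q - 1)))) as [A [HA HPA]].
  assert (HA1 : 1 <= A /\ INR N <= A /\ 2 / (Q - 1) <= A).
  { pose proof (Rmax_l (Rmax 1 (INR N)) (2 / (Q - 1))).
    pose proof (Rmax_r (Rmax 1 (INR N)) (2 / (Q - 1))).
    pose proof (Rmax_l 1 (INR N)). pose proof (Rmax_r 1 (INR N)). lra. }
  destruct HA1 as (HA1 & HAN & HAQ).
  assert (H2 : 2 <= (Q - 1) * A).
  { apply (Rmult_le_compat_l (Q - 1)) in HAQ; [| lra].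
    replace ((Q - 1) * (2 / (Q - 1))) with 2 in HAQ by (field; lra). exact HAQ. }
  destruct (nfloor_ex A) as [p [Hp1 Hp2]]; [lra|].
  destruct (nfloor_ex (Q * A)) as [q [Hq1 Hq2]]; [nra|].
  assert (HpN : (N <= S p)%nat).
  { apply INR_le. rewrite S_INR. lra. }
  assert (Hpq : (S p <= q)%nat).
  { apply INR_le. rewrite S_INR.
    assert (INR p < INR q) by lra. apply INR_lt in H.
    apply le_INR in H. rewrite S_INR in H. lra. }
  specialize (HN (S p) q HpN ltac:(lia)).
  assert (Hlow : INR (S q - S p) * / (Q * A) <=
    sum_n_m (restrict_to (V := R_AbelianMonoid) P (fun n => / INR n)) (S p) q).
  { apply sum_n_m_ge_const. intros n [Hn1 Hn2].
    apply le_INR in Hn1, Hn2. rewrite S_INR in Hn1.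
    unfold restrict_to. destruct (excluded_middle_informative _) as [_|Hno].
    - apply Rinv_le_contravar; lra.
    - exfalso. apply Hno, HPA. lra. }
  assert (Hc : (1 - / Q) / 2 <= INR (S q - S p) * / (Q * A)).
  { rewrite minus_INR, !S_INR by lia.
    apply (Rmult_le_reg_r (Q * A)); [nra|].
    rewrite Rmult_assoc, Rinv_l, Rmult_1_r by nra.
    replace ((1 - / Q) / 2 * (Q * A)) with ((Q - 1) * A / 2) by (field; lra).
    lra. }
  change (Rabs (sum_n_m (restrict_to (V := R_AbelianMonoid) P
    (fun n => / INR n)) (S p) q) < (1 - / Q) / 4) in HN.
  pose proof (Rle_abs (sum_n_m (restrict_to (V := R_AbelianMonoid) P
    (fun n => / INR n)) (S p) q)). lra.
Qed.

(** Starting where the phase is a multiple of [2 * PI], multiplying [n] by at most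
    [exp (PI / 6 / t)] advances the phase by at most [PI / 6]. *)
Lemma cos_log_blocks (t phi : R) :
  0 < t ->
  forall M, exists A, M <= A /\
    forall n : nat, A <= INR n <= exp (PI / 6 / t) * A ->
      3 / 4 <= cos (phi + t * ln (INR n)).
Proof.
  intros Ht M. pose proof PI_RGT_0 as HPI.
  set (B := (phi + t * M) / (2 * PI)).
  destruct (nfloor_ex (Rmax 0 B)) as [k [_ Hk]]; [apply Rmax_l|].
  (* This [L] solves [phi + t * L = 2 * PI * (k + 1)]. Since [k + 1 > B], it is at least [M], and
     [exp L] is larger still. *)
  set (L := (2 * INR (S k) * PI - phi) / t).
  assert (HtL : t * L = 2 * INR (S k) * PI - phi) by (unfold L; field; lra).
  assert (HML : M <= L).
  { apply (Rmult_le_reg_l t); [exact Ht|]. rewrite HtL.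
    pose proof (Rmax_r 0 B). rewrite S_INR.
    assert (HB : B * (2 * PI) = phi + t * M) by (unfold B; field; lra).
    nra. }
  exists (exp L). split.
  { pose proof (exp_ineq1_le L). lra. }
  intros n [H1 H2]. pose proof (exp_pos L).
  rewrite <- exp_plus in H2.
  assert (L <= ln (INR n) <= PI / 6 / t + L) as [H3 H4].
  { split.
    - rewrite <- (ln_exp L). apply ln_le; lra.
    - rewrite <- (ln_exp (PI / 6 / t + L)). apply ln_le; lra. }
  assert (H5 : t * (PI / 6 / t + L) = PI / 6 + t * L) by (field; lra).
  apply (Rmult_le_compat_l t) in H3, H4; try lra.
  replace (phi + t * ln (INR n)) with
    ((phi + t * ln (INR n) - 2 * INR (S k) * PI) + 2 * INR (S k) * PI) by ring.
  rewrite cos_period. apply cos_PI6_ge. apply Rabs_le. lra.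
Qed.

(** * The terms [1 / n^(1+it)]: modulus [1/n], argument [-t ln n] *)

Lemma inv_nat_Cpow (t : R) (n : nat) :
  (1 <= n)%nat ->
  Cdiv (RtoC 1) (nat_Cpow n (Cplus (RtoC 1) (Cmult Ci (RtoC t)))) =
  (/ INR n * cos (t * ln (INR n)), - (/ INR n * sin (t * ln (INR n)))).
Proof.
  intros Hn. assert (Hp : 0 < INR n) by (apply lt_0_INR; lia).
  unfold nat_Cpow, Cexp.
  replace (Re ((1 + Ci * t) * ln (INR n))%C) with (ln (INR n))
    by (unfold Re; simpl; ring).
  replace (Im ((1 + Ci * t) * ln (INR n))%C) with (t * ln (INR n))
    by (unfold Im; simpl; ring).
  rewrite exp_ln by exact Hp. set (x := t * ln (INR n)).
  pose proof (sin2_cos2 x) as E. unfold Rsqr in E.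
  assert (HD : (INR n * cos x) ^ 2 + (INR n * sin x) ^ 2 = INR n * INR n).
  { transitivity (INR n * INR n * (sin x * sin x + cos x * cos x)); [ring|].
    rewrite E. ring. }
  unfold Cdiv, Cinv, Cmult, RtoC; cbn [fst snd]. rewrite HD.
  f_equal; field; lra.
Qed.

Lemma Cmod_inv_nat_Cpow (t : R) (n : nat) :
  (1 <= n)%nat ->
  Cmod (Cdiv (RtoC 1) (nat_Cpow n (Cplus (RtoC 1) (Cmult Ci (RtoC t))))) = / INR n.
Proof.
  intros Hn. assert (Hp : 0 < / INR n) by (apply Rinv_0_lt_compat, lt_0_INR; lia).
  rewrite inv_nat_Cpow by exact Hn.
  pose proof (sin2_cos2 (t * ln (INR n))) as E. unfold Rsqr in E.
  unfold Cmod; cbn [fst snd].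
  rewrite <- (sqrt_Rsqr (/ INR n)) at 3 by lra. f_equal. unfold Rsqr.
  transitivity (/ INR n * / INR n * (sin (t * ln (INR n)) * sin (t * ln (INR n))
    + cos (t * ln (INR n)) * cos (t * ln (INR n)))); [ring|].
  rewrite E. ring.
Qed.

Lemma aligned_diverges (t : R) (u : C) :
  t <> 0 ->
  let a n := Cdiv (RtoC 1) (nat_Cpow n (Cplus (RtoC 1) (Cmult Ci (RtoC t)))) in
  ~ ex_series (restrict_to (aligned a u) (fun n => Cmod (a n))).
Proof.
  intros Ht a Hs. destruct (polar_form u) as [phi [Hre Him]].
  assert (Hcos : exists Q, 1 < Q /\ forall M, exists A, M <= A /\
    forall n : nat, A <= INR n <= Q * A -> 3 / 4 <= cos (phi + t * ln (INR n))).
  { assert (HQ : forall s, 0 < s -> 1 < exp (PI / 6 / s)).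
    { intros s Hs'. rewrite <- exp_0. apply exp_increasing.
      pose proof PI_RGT_0. repeat apply Rdiv_lt_0_compat; lra. }
    destruct (Rlt_dec 0 t) as [Hp|Hn].
    - exists (exp (PI / 6 / t)). split; [auto | now apply cos_log_blocks].
    (* For negative [t], both the phase and [phi] are negated, which leaves the cosine unchanged. *)
    - exists (exp (PI / 6 / (- t))). split; [apply HQ; lra|].
      intros M. destruct (cos_log_blocks (- t) (- phi)) with (M := M) as [A [HA H]];
        [lra|].
      exists A. split; [exact HA|]. intros n Hn'.
      rewrite <- cos_neg.
      replace (- (phi + t * ln (INR n))) with (- phi + - t * ln (INR n)) by ring.
      auto. }
  destruct Hcos as [Q [HQ Hcos]].
  apply (harmonic_blocks_diverge (fun n => (1 <= n)%nat /\ aligned a u n) Q HQ).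
  - intros M. destruct (Hcos (Rmax 1 M)) as [A [HA H]].
    pose proof (Rmax_l 1 M). pose proof (Rmax_r 1 M).
    exists A. split; [lra|]. intros n Hn.
    assert (Hn1 : (1 <= n)%nat) by (apply INR_le; simpl; lra).
    split; [exact Hn1|]. specialize (H n Hn).
    unfold aligned. unfold a at 1. rewrite Cmod_inv_nat_Cpow by exact Hn1.
    unfold a. rewrite inv_nat_Cpow by exact Hn1.
    (* The arguments of [u] and [a n] are [phi] and [- t * ln (INR n)], so their angle is the phase
       controlled by [Hcos]. *)
    assert (E : Re (Cmult (Cconj u) (/ INR n * cos (t * ln (INR n)),
      - (/ INR n * sin (t * ln (INR n))))%R) =
      Cmod u * / INR n * cos (phi + t * ln (INR n))).
    { transitivity (Re u * (/ INR n * cos (t * ln (INR n))) -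
        Im u * (/ INR n * sin (t * ln (INR n)))).
      - destruct u as [x y]. unfold Re, Im, Cconj, Cmult; simpl. ring.
      - rewrite Hre, Him, cos_plus. ring. }
    rewrite E.
    assert (0 < / INR n) by (apply Rinv_0_lt_compat, lt_0_INR; lia).
    pose proof (Cmod_ge_0 u).
    rewrite Rmult_comm. apply Rmult_le_compat_l; [nra | exact H].
  - apply ex_series_eventually_le with (2 := Hs) (N := 1%nat).
    intros n Hn. unfold restrict_to.
    assert (0 < / INR n) by (apply Rinv_0_lt_compat, lt_0_INR; lia).
    destruct (excluded_middle_informative (_ /\ _)) as [[_ Hal]|Hno];
      destruct (excluded_middle_informative (aligned a u n)); try tauto.
    + unfold a. rewrite Cmod_inv_nat_Cpow by exact Hn. lra.
    + change (@zero R_AbelianMonoid) with 0. lra.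
Qed.

Theorem theorem1p3 (t : R) (lambda : C) (ht : t <> 0) :
  exists S : nat -> Prop,
    (forall n : nat, S n -> (2 <= n)%nat) /\
    ex_series (restrict_to S (fun n : nat => 1 / INR n)) /\
    is_series
      (restrict_to S
         (fun n : nat => Cdiv (RtoC 1) (nat_Cpow n (Cplus (RtoC 1) (Cmult Ci (RtoC t))))))
      lambda.
Proof.
  set (a := fun n : nat =>
    Cdiv (RtoC 1) (nat_Cpow n (Cplus (RtoC 1) (Cmult Ci (RtoC t))))).
  (* The starting index 2 keeps every selected integer at least 2. *)
  exists (greedy 2 a lambda). split; [| split].
  - intros n Hn. apply Hn.
  - apply ex_series_eventually_le with (2 := greedy_summable 2 a lambda) (N := 1%nat).
    intros n Hn. unfold restrict_to.
    assert (0 < / INR n) by (apply Rinv_0_lt_compat, lt_0_INR; lia).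
    destruct (excluded_middle_informative _).
    + unfold a. rewrite Cmod_inv_nat_Cpow by exact Hn. lra.
    + change (@zero R_AbelianMonoid) with 0. lra.
  - apply is_series_greedy.
    + apply is_lim_seq_ext_loc with (fun n => / INR n).
      * exists 1%nat. intros n Hn. symmetry. now apply Cmod_inv_nat_Cpow.
      * apply (is_lim_seq_inv INR p_infty is_lim_seq_INR). discriminate.
    + intros u _. now apply aligned_diverges.
Qed.
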